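(* (Bilinear Young inequality.) Let $1\le p_0\le\infty$ and $K\in L^{p_0}(\mathbb{R})$. Let $1\le p_i\le\infty$ for $i=1,2,3$ with $$\frac{1}{p_1}+\frac{1}{p_2}+\frac{1}{p_0}=1+\frac{1}{p_3},$$ and let $\alpha,\beta\in\mathbb{R}\setminus\{0\}$ with $\alpha\ne\beta$. Then $H_{K,\alpha,\beta}$ is a bounded operator from $L^{p_1}(\mathbb{R})\times L^{p_2}(\mathbb{R})$ to $L^{p_3}(\mathbb{R})$. Moreover, $$\|H_{K,\alpha,\beta}(f,g)\|_{p_3}\le C_{\alpha,\beta,p_0,p_1,p_2}\,\|K\|_{p_0}\|f\|_{p_1}\|g\|_{p_2},$$ where the constant $C_{\alpha,\beta,p_0,p_1,p_2}$ depends only on $\alpha,\beta,p_0,p_1,p_2$.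
   Context: For a function $K$ on $\mathbb{R}$ and $\alpha,\beta\in\mathbb{R}$, the bilinear operator $H_{K,\alpha,\beta}$ is $$H_{K,\alpha,\beta}(f,g)(x)=\int_{\mathbb{R}}f(x-\alpha t)\,g(x-\beta t)\,K(t)\,dt,\qquad x\in\mathbb{R},$$ initially defined for $f,g$ in the Schwartz class $\mathcal{S}(\mathbb{R})$. That it is a bounded operator from $L^{p_1}\times L^{p_2}$ to $L^{p_3}$ means that it extends to a bounded bilinear operator between these spaces. $\|\cdot\|_p$ is the usual $L^p(\mathbb{R})$ norm, and $1/\infty=0$. *)

(* Defs.v *)
From HB Require Import structures.
From mathcomp Require Import all_boot all_order all_algebra.
From mathcomp Require Export complex.
From mathcomp Require Export all_classical all_reals all_analysis.

Set Implicit Arguments.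
Unset Strict Implicit.
Unset Printing Implicit Defensive.

Import Order.TTheory GRing.Theory Num.Theory.
Import numFieldNormedType.Exports.

Local Open Scope classical_set_scope.
Local Open Scope ring_scope.
Local Open Scope complex_scope.

Section Definitions.
Context {R : realType}.
Local Notation mu := (@lebesgue_measure R).
Implicit Types (f g K : R -> R[i]) (p : \bar R).

Definition cmod (z : R[i]) : R := ComplexField.Normc.normc z.

(* Measurability and integrals of complex-valued functions are taken on real
   and imaginary parts: no measurable or normed R-module structure on [R[i]]
   is available. *)
Definition cmeasurable f : Prop :=
  measurable_fun [set: R] (fun x => complex.Re (f x)) /\
  measurable_fun [set: R] (fun x => complex.Im (f x)).

Definition cintegrable f : Prop :=
  mu.-integrable [set: R] (fun x => (complex.Re (f x))%:E) /\
  mu.-integrable [set: R] (fun x => (complex.Im (f x))%:E).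

Definition cintegral f : R[i] :=
  (\int[mu]_x complex.Re (f x)) +i* (\int[mu]_x complex.Im (f x)).

Definition cLnorm p f : \bar R := Lnorm mu p (fun x => (cmod (f x))%:E).

(* Elements of L^p are represented by Borel functions, with no quotient by
   almost-everywhere equality. *)
Definition cLp p f : Prop := cmeasurable f /\ (cLnorm p f < +oo)%E.

Definition cderive1n (n : nat) f (x : R) : R[i] :=
  derive1n n (fun y => complex.Re (f y)) x +i*
  derive1n n (fun y => complex.Im (f y)) x.

Definition schwartz f : Prop :=
  (forall (n : nat) (x : R),
     derivable (derive1n n (fun y => complex.Re (f y))) x 1 /\
     derivable (derive1n n (fun y => complex.Im (f y))) x 1) /\
  (forall k n : nat, exists M : R, forall x : R,
     `|x| ^+ k * cmod (cderive1n n f x) <= M).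

Definition bilinear_integrand K (alpha beta : R) f g (x t : R) : R[i] :=
  f (x - alpha * t) * g (x - beta * t) * K t.

(* Meaningful only where [bilinear_integrand K alpha beta f g x] is [cintegrable]. *)
Definition bilinear_H K (alpha beta : R) f g (x : R) : R[i] :=
  cintegral (bilinear_integrand K alpha beta f g x).

(* Bilinearity and the bound together make [T] compatible with
   almost-everywhere equality in each argument, so that it induces an operator
   between the quotient spaces. *)
Record bounded_bilinear (p1 p2 p3 : \bar R)
    (T : (R -> R[i]) -> (R -> R[i]) -> (R -> R[i])) : Prop := {
  bounded_bilinear_codomain : forall f g,
    cLp p1 f -> cLp p2 g -> cLp p3 (T f g);
  bounded_bilinear_linearl : forall (a : R[i]) f1 f2 g,
    cLp p1 f1 -> cLp p1 f2 -> cLp p2 g ->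
    \forall x \ae mu,
      T (fun y => a * f1 y + f2 y) g x = a * T f1 g x + T f2 g x;
  bounded_bilinear_linearr : forall (a : R[i]) f g1 g2,
    cLp p1 f -> cLp p2 g1 -> cLp p2 g2 ->
    \forall x \ae mu,
      T f (fun y => a * g1 y + g2 y) x = a * T f g1 x + T f g2 x;
  bounded_bilinear_bound : exists B : R, forall f g,
    cLp p1 f -> cLp p2 g ->
    (cLnorm p3 (T f g) <= B%:E * cLnorm p1 f * cLnorm p2 g)%E }.

Definition bounded_extension (p1 p2 p3 : \bar R)
    (S T : (R -> R[i]) -> (R -> R[i]) -> (R -> R[i])) : Prop :=
  bounded_bilinear p1 p2 p3 T /\
  forall f g, schwartz f -> schwartz g ->
    \forall x \ae mu, T f g x = S f g x.

End Definitions.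

(* Main.v *)
Require Import Defs.
From mathcomp Require Import all_boot all_order all_algebra.
From mathcomp Require Import complex.
From mathcomp Require Import all_classical all_reals all_analysis.
From HB Require Import structures.
From mathcomp Require Import ring lra ess_sup_inf measurable_realfun.
Import Order.TTheory GRing.Theory Num.Theory.
Import numFieldNormedType.Exports.
Local Open Scope classical_set_scope.
Local Open Scope ring_scope.

(** Write theta_i = 1/p_i and s = 1/p3. After replacing |f|, |g|, |K| by
    ||f|| a^theta_1, ||g|| b^theta_2, ||K|| c^theta_0 with a, b, c of integral at
    most 1, the theta's satisfy theta_1 + theta_2 + theta_0 = 1 + s, which gives
    the pointwise bound
      a^theta_1 b^theta_2 c^theta_0 <= (bc + ac + ab)^s (a + b + c)^(1-s).
    Hoelder's inequality in t then yields |H(x)| <= const * A(x)^s * M^(1-s), where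
    A(x) is the integral in t of bc + ac + ab along the three linear forms
    x - alpha t, x - beta t, t, and M bounds that of a + b + c. The forms are
    pairwise independent, so by Tonelli and affine changes of variables A is
    integrable, and raising to the power p3 = 1/s gives the claim (for s = 0 the bound on H is
    already uniform). *)

(** * Real powers and the pointwise inequality *)

(** Since 0 to the power 0 is 1, the law of exponents fails at base 0 exactly when the exponents
    cancel without vanishing; nonnegative exponents cannot do that. *)
Lemma powRD_ge0 {R : realType} (a x y : R) :
  0 <= x -> 0 <= y -> a `^ (x + y) = a `^ x * a `^ y.
Proof.
move=> x0 y0; have [->|a0] := eqVneq a 0; last first.
  by rewrite powRD// a0 implybT.
have [->|xn0] := eqVneq x 0; first by rewrite add0r powRr0 mul1r.
by rewrite powRD// paddr_eq0// (negbTE xn0).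
Qed.

(* [(t1, t2, t3, 1 - s)] lies in the hypersimplex [{u in [0,1]^4 | sum u = 2}],
   so it is a convex combination of sums of two basis vectors. The weights [n]
   are those of the pairs inside [{1, 2, 3}], the weights [m] those of the
   pairs containing the last index. *)
Lemma hypersimplex_decomposition {R : realType} (t1 t2 t3 s : R) :
  0 <= t1 <= 1 -> 0 <= t2 <= 1 -> 0 <= t3 <= 1 -> 0 <= s <= 1 ->
  t1 + t2 + t3 = 1 + s ->
  exists n : (R * R * R) * (R * R * R),
    let: ((n1, n2, n3), (m1, m2, m3)) := n in
    [/\ [/\ 0 <= n1, 0 <= n2 & 0 <= n3], [/\ 0 <= m1, 0 <= m2 & 0 <= m3],
        n1 + n2 + n3 = s, m1 + m2 + m3 = 1 - s &
        [/\ t1 = m1 + n2 + n3, t2 = m2 + n1 + n3 & t3 = m3 + n1 + n2]].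
Proof.
move=> /andP[? ?] /andP[? ?] /andP[? ?] /andP[? ?] ?.
(* As the [n] sum to [s], the condition [0 <= m1] reads [s - t1 <= n1], and likewise for the second
   index. So [n1] and [n2] take their least admissible values, [n3] takes the rest of [s], and the
   [m] are forced. *)
exists (let n1 := Num.max 0 (s - t1) in let n2 := Num.max 0 (s - t2) in
  let n3 := s - n1 - n2 in
  ((n1, n2, n3), (t1 - n2 - n3, t2 - n1 - n3, t3 - n1 - n2))).
have [?|?] := leP 0 (s - t1); have [?|?] := leP 0 (s - t2) => /=.
all: by split; first [split | idtac]; lra.
Qed.

(** The decomposition of the exponents regroups the left side into powers of the pair products, with
    exponents summing to [s], times powers of [a], [b], [c], with exponents summing to [1 - s]. Each
    pair product is at most the sum of the three, and each of [a], [b], [c] at most [a + b + c]. *)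
Lemma prod3_powR_le {R : realType} (a b c t1 t2 t3 s : R) :
  0 <= a -> 0 <= b -> 0 <= c ->
  0 <= t1 <= 1 -> 0 <= t2 <= 1 -> 0 <= t3 <= 1 -> 0 <= s <= 1 ->
  t1 + t2 + t3 = 1 + s ->
  a `^ t1 * b `^ t2 * c `^ t3 <=
  (b * c + a * c + a * b) `^ s * (a + b + c) `^ (1 - s).
Proof.
move=> a0 b0 c0 t101 t201 t301 s01 ts.
have [[[[n1 n2] n3] [[m1 m2] m3]] [[n10 n20 n30] [m10 m20 m30] <- <-]] :=
  hypersimplex_decomposition _ _ _ _ t101 t201 t301 s01 ts.
move=> [-> -> ->].
have [bc0 ac0 ab0] : [/\ 0 <= b * c, 0 <= a * c & 0 <= a * b].
  by rewrite !mulr_ge0.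
set u := (b * c + a * c + a * b); set v := a + b + c.
have le_u x w : 0 <= x -> x <= u -> 0 <= w -> x `^ w <= u `^ w.
  move=> x0 xu w0; rewrite ge0_ler_powR// ?nnegrE//.
  exact: le_trans xu.
have le_v x w : 0 <= x -> x <= v -> 0 <= w -> x `^ w <= v `^ w.
  move=> x0 xu w0; rewrite ge0_ler_powR// ?nnegrE//.
  exact: le_trans xu.
have -> : a `^ (m1 + n2 + n3) * b `^ (m2 + n1 + n3) * c `^ (m3 + n1 + n2) =
  ((b * c) `^ n1 * (a * c) `^ n2 * (a * b) `^ n3) *
  (a `^ m1 * b `^ m2 * c `^ m3).
  by rewrite !powRM// !powRD_ge0 ?addr_ge0//; ring.
rewrite !(@powRD_ge0 _ u) ?addr_ge0// !(@powRD_ge0 _ v) ?addr_ge0//.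
by rewrite !ler_pM ?mulr_ge0 ?powR_ge0 ?le_u ?le_v// /u /v; lra.
Qed.

#[local] Instance ae_lebesgue_filter {R : realType} :
  Filter (nbhs (almost_everywhere (@lebesgue_measure R))).
Proof. exact: (ae_filter_ringOfSetsType (@lebesgue_measure R)). Qed.

(** * Affine changes of variables on the line *)

Section affine_change_of_variables.
Context {R : realType}.
Local Notation mu := (@lebesgue_measure R).
Local Open Scope ereal_scope.

Let affine (a b : R) : measurableTypeR R -> measurableTypeR R :=
  fun x => (a * x + b)%R.

Let measurable_affine a b : measurable_fun [set: measurableTypeR R] (affine a b).
Proof. by apply: measurable_funD => //; exact: measurable_funM. Qed.

(** The pushforward of [mu] under the affine map, scaled by the absolute value of [a], gives
    half-open intervals their length, so uniqueness identifies it with [mu]. *)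
Lemma lebesgue_measure_affine (a b : R) (A : set R) : a != 0%R -> measurable A ->
  mu ((fun x => a * x + b)%R @^-1` A) = `|a|^-1%:E * mu A.
Proof.
move=> a0 mA.
pose h : {mfun measurableTypeR R >-> measurableTypeR R} :=
  HB.pack (affine a b) (isMeasurableFun.Build _ _ _ _ _ (measurable_affine a b)).
have an : (0 <= `|a|)%R by [].
have aE : (`|a|^-1 * `|a| = 1)%R by rewrite mulVf// normr_eq0.
rewrite (@lebesgue_measure_unique R (mscale (NngNum an) (pushforward mu h)) _ _ mA).
  by rewrite /= /mscale/= muleA -EFinM aE mul1e.
move=> _ [[x y] _ <-]; rewrite /= /mscale/= /pushforward.
have [a_gt0|a_lt0|aE0] := ltgtP 0%R a; last by rewrite -aE0 eqxx in a0.
- have -> : h @^-1` `]x, y] = `]((x - b) / a)%R, ((y - b) / a)%R]%classic.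
    apply/seteqP; split => z /=; rewrite !in_itv/= /affine => /andP[].
      by rewrite ltr_pdivrMr// ler_pdivlMr// (mulrC z) ltrBlDr lerBrDr => -> ->.
    by rewrite ltr_pdivrMr// ler_pdivlMr// (mulrC z) ltrBlDr lerBrDr => -> ->.
  rewrite !lebesgue_measure_itv/= !lte_fin ltr_pM2r ?invr_gt0// ltrD2r.
  case: ifPn => _; last by rewrite mule0.
  by rewrite -!EFinD -EFinM gtr0_norm//; congr EFin; field.
(* A negative slope reverses the interval, so the preimage is closed on the left and open on the
   right; its length is unaffected. *)
- have -> : h @^-1` `]x, y] = `[((y - b) / a)%R, ((x - b) / a)%R[%classic.
    apply/seteqP; split => z /=; rewrite !in_itv/= /affine => /andP[].
      by rewrite ler_ndivrMr// ltr_ndivlMr// (mulrC z) ltrBlDr lerBrDr => -> ->.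
    by rewrite ler_ndivrMr// ltr_ndivlMr// (mulrC z) ltrBlDr lerBrDr => -> ->.
  rewrite !lebesgue_measure_itv/= !lte_fin ltr_nM2r ?invr_lt0// ltrD2r.
  case: ifPn => _; last by rewrite mule0.
  by rewrite -!EFinD -EFinM ltr0_norm//; congr EFin; field; rewrite lt_eqF.
Qed.

Lemma ge0_integral_affine (a b : R) (f : R -> \bar R) : a != 0%R ->
  measurable_fun [set: R] f -> (forall x, 0 <= f x) ->
  \int[mu]_x f (a * x + b)%R = `|a|^-1%:E * \int[mu]_x f x.
Proof.
move=> a0 mf f0.
have an : (0 <= `|a|^-1)%R by rewrite invr_ge0.
transitivity (\int[mscale (NngNum an) mu]_x f x); last first.
  by rewrite ge0_integral_mscale.
transitivity (\int[pushforward mu (affine a b)]_x f x).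
  by rewrite ge0_integral_pushforward// ?preimage_setT//; exact: measurable_affine.
by apply: eq_measure_integral => A mA _; exact: lebesgue_measure_affine.
Qed.

(** Preimages of null sets are null. For fixed x this carries a bound valid for almost every y over
    to y = x - alpha t for almost every t. *)
Lemma ae_affine (a b : R) (P : R -> Prop) : a != 0%R ->
  (\forall x \ae mu, P x) -> \forall x \ae mu, P (a * x + b)%R.
Proof.
move=> a0 [N [mN N0 PN]]; exists ((fun x => a * x + b)%R @^-1` N); split.
- rewrite -[_ @^-1` _]setTI.
  exact: measurable_affine.
- by rewrite lebesgue_measure_affine// N0 mule0.
- by move=> x /= /PN.
Qed.

End affine_change_of_variables.

(** * Hoelder's inequality, and norm bounds from pointwise powers *)

(** For 0 < s < 1 this is Hoelder's inequality for the conjugate exponents 1/s and 1/(1 - s). At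
    both endpoints one factor is constantly 1 on each side, even if its integral is infinite, and
    equality holds. *)
Lemma hoelder_powR {d : measure_display} {T : measurableType d} {R : realType}
    (mu : {measure set T -> \bar R}) (u v : T -> R) (s : R) :
  measurable_fun [set: T] u -> measurable_fun [set: T] v ->
  (forall x, 0 <= u x) -> (forall x, 0 <= v x) -> 0 <= s <= 1 ->
  (\int[mu]_x (u x `^ s * v x `^ (1 - s))%:E <=
   (\int[mu]_x (u x)%:E) `^ s * (\int[mu]_x (v x)%:E) `^ (1 - s))%E.
Proof.
move=> mf mg u0 v0 /andP[].
have iu0 : (0 <= \int[mu]_x (u x)%:E)%E by apply: integral_ge0 => x _; rewrite lee_fin.
have iv0 : (0 <= \int[mu]_x (v x)%:E)%E by apply: integral_ge0 => x _; rewrite lee_fin.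
rewrite le_eqVlt => /predU1P[<- _|s0].
  rewrite subr0 poweRe0 mul1e poweRe1//.
  by under eq_integral do rewrite powRr0 mul1r powRr1//.
rewrite le_eqVlt => /predU1P[->|s1].
  rewrite subrr poweRe0 mule1 poweRe1//.
  by under eq_integral do rewrite powRr0 mulr1 powRr1//.
have s1' : 0 < 1 - s by rewrite subr_gt0.
have mpow (w : T -> R) r : measurable_fun [set: T] w ->
    measurable_fun [set: T] (fun x : T => w x `^ r).
  by move=> mw; exact: (measurableT_comp (measurable_powR _)).
have := @hoelder _ _ _ mu (fun x => u x `^ s) (fun x => v x `^ (1 - s)) s^-1 (1 - s)^-1.
move=> /(_ (mpow _ _ mf) (mpow _ _ mg)).
rewrite !invr_gt0 !invrK => /(_ s0 s1').
rewrite addrC subrK => /(_ erefl).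
rewrite Lnorm1 !unlock/= !invrK.
under [X in (X <= _)%E -> _]eq_integral do rewrite ger0_norm ?mulr_ge0 ?powR_ge0//.
under [X in (_ <= X `^ _ * _)%E -> _]eq_integral do
  rewrite ger0_norm ?powR_ge0// -powRrM divff ?gt_eqF// powRr1//.
under [X in (_ <= _ * X `^ _)%E -> _]eq_integral do
  rewrite ger0_norm ?powR_ge0// -powRrM divff ?gt_eqF// powRr1//.
by [].
Qed.

(** For finite [p] the hypothesis is raised to the power [p], integrated, and the root is taken. For
    [p = +oo] the exponent is 0, the power of [A] is 1, and the hypothesis already bounds the
    essential supremum by [k]. *)
Lemma Lnorm_le_powR {d : measure_display} {T : measurableType d} {R : realType}
    (mu : {measure set T -> \bar R}) (h A : T -> \bar R) (p : \bar R) (k D : R) :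
  measurable_fun [set: T] h -> measurable_fun [set: T] A ->
  (forall x, 0 <= A x)%E -> 0 <= k -> 0 <= D -> (1 <= p)%E ->
  (\forall x \ae mu, `|h x| <= k%:E * A x `^ fine p^-1)%E ->
  (\int[mu]_x A x <= D%:E)%E ->
  (Lnorm mu p h <= (k * D `^ fine p^-1)%:E)%E.
Proof.
move=> mh mA A0 k0 D0; rewrite unlock; case: p => [r|_|//]; last first.
  rewrite invey/= => hA _; rewrite powRr0 mulr1.
  (* The norm of exponent [+oo] is 0 by convention when the whole space has measure 0. *)
  case: ifPn => _; last by rewrite lee_fin.
  by apply/ess_supP; apply: filterS hA => x; rewrite poweRe0 mule1.
rewrite lee_fin => r1; have r0 : 0 < r by exact: lt_le_trans r1.
rewrite inver gt_eqF//= => hA iA.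
have -> : ((k * D `^ r^-1)%:E = ((k `^ r * D)%:E) `^ r^-1)%E.
  by rewrite poweR_EFin powRM ?powR_ge0// -powRrM divff ?gt_eqF// powRr1.
apply: gt0_ler_poweR; rewrite ?invr_ge0 ?(ltW r0)//.
- by rewrite in_itv/= leey andbT integral_ge0// => x _; exact: poweR_ge0.
- by rewrite in_itv/= leey andbT lee_fin mulr_ge0 ?powR_ge0.
rewrite EFinM; apply: le_trans (lee_wpmul2l _ iA); last by rewrite lee_fin powR_ge0.
rewrite -ge0_integralZl_EFin ?powR_ge0//.
apply: ae_ge0_le_integral => //.
- by move=> x _; exact: poweR_ge0.
- by apply: (measurableT_comp (measurable_poweR _)); exact: measurableT_comp.
- by move=> x _; rewrite mule_ge0// lee_fin powR_ge0.
- exact: measurable_funeM.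
apply: filterS hA => x hx _.
apply: (@le_trans _ _ ((k%:E * A x `^ r^-1) `^ r)%E).
  by rewrite gt0_ler_poweR ?(ltW r0)// in_itv/= leey andbT// mule_ge0// poweR_ge0.
by rewrite poweRM ?poweR_ge0// -poweRrM mulVf ?gt_eqF// poweRe1// poweR_EFin.
Qed.

(** * Integrals of products along two linear forms *)

Section linear_forms.
Context {R : realType}.
Local Notation mu := (@lebesgue_measure R).

Lemma measurable_linear_form (f : R -> R) (a b : R) :
  measurable_fun [set: R] f ->
  measurable_fun [set: R * R] (fun z => f (a * z.1 + b * z.2)).
Proof.
move=> mf; apply: (measurableT_comp mf).
by apply: measurable_funD; exact: measurable_funM.
Qed.

Lemma measurable_shear (f : R -> R) (a : R) : measurable_fun [set: R] f ->
  measurable_fun [set: R * R] (fun z => f (z.1 - a * z.2)).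
Proof.
move=> /measurable_linear_form => /(_ 1 (- a)).
by apply: eq_measurable_fun => z _; rewrite mul1r mulNr.
Qed.

(** The forms [x - a * t] and [c * x + d * t] have determinant [c * a + d]. The change of variables
    is done one variable at a time: exchange the integrals, translate [x] by [a * t], exchange back,
    and rescale in [t]. *)
Lemma integral_linear_forms (f g : R -> R) (a c d : R) : c * a + d != 0 ->
  measurable_fun [set: R] f -> measurable_fun [set: R] g ->
  (forall x, 0 <= f x) -> (forall x, 0 <= g x) ->
  (\int[mu]_x \int[mu]_t (f (x - a * t) * g (c * x + d * t))%:E =
   `|c * a + d|^-1%:E * (\int[mu]_x (f x)%:E * \int[mu]_x (g x)%:E))%E.
Proof.
move=> cad0 mf mg f0 g0.
pose F (z : R * R) := (f (z.1 - a * z.2) * g (c * z.1 + d * z.2))%:E.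
have mF : measurable_fun [set: R * R] F.
  apply/measurable_EFinP; apply: measurable_funM; first exact: measurable_shear.
  exact: measurable_linear_form.
rewrite (fubini_tonelli (m1 := mu) (m2 := mu) F)//; last first.
  by move=> z; rewrite lee_fin mulr_ge0.
pose G (z : R * R) := (f z.1 * g ((c * a + d) * z.2 + c * z.1))%:E.
have mG : measurable_fun [set: R * R] G.
  apply/measurable_EFinP; apply: measurable_funM.
    exact: (measurableT_comp mf).
  have := measurable_linear_form _ c (c * a + d) mg.
  by apply: eq_measurable_fun => z _; rewrite addrC.
transitivity (\int[mu]_t \int[mu]_x G (x, t))%E.
  apply: eq_integral => t _.
  (* A translation is the affine map of slope 1; the factor 1 is inserted as its Jacobian. *)
  rewrite -[RHS]mul1e -invr1 -(normr1 R) -(@ge0_integral_affine _ _ (- (a * t)))//.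
  - by apply: eq_integral => x _; rewrite /F /G/= !mul1r; congr (f _ * g _)%:E; ring.
  - exact: (measurableT_comp mG).
  - by move=> x; rewrite lee_fin mulr_ge0.
rewrite -(fubini_tonelli (m1 := mu) (m2 := mu) G)//; last first.
  by move=> z; rewrite lee_fin mulr_ge0.
transitivity (\int[mu]_x ((f x)%:E * (`|c * a + d|^-1%:E * \int[mu]_x (g x)%:E)))%E.
  apply: eq_integral => x _; rewrite /G/=.
  under eq_integral do rewrite EFinM.
  rewrite ge0_integralZl_EFin//.
  - congr (_ * _)%E.
    rewrite (ge0_integral_affine _ _ (EFin \o g))//.
    exact/measurable_EFinP.
  - by move=> t _; rewrite lee_fin.
  - apply/measurable_EFinP; apply: (measurableT_comp mg).
    by apply: measurable_funD => //; exact: measurable_funM.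
rewrite ge0_integralZr//.
- by rewrite muleCA.
- exact/measurable_EFinP.
- by move=> x _; rewrite lee_fin.
- by rewrite mule_ge0// integral_ge0// => x _; rewrite lee_fin.
Qed.

End linear_forms.

(** * The normalised inequality for nonnegative functions *)

Section young_nonnegative.
Set Implicit Arguments.
Unset Strict Implicit.
Context {R : realType}.
Local Notation mu := (@lebesgue_measure R).

(** One common majorant of the two bounds below: 1 + 1 + 1/|alpha - beta| for the integral of the
    pair products, and 1/|alpha| + 1/|beta| + 1 for that of the sum. A single constant lets its
    powers [s] and [1 - s] recombine. *)
Definition young_constant (alpha beta : R) : R :=
  2 + `|alpha|^-1 + `|beta|^-1 + `|alpha - beta|^-1.

Lemma young_constant_ge1 (alpha beta : R) : 1 <= young_constant alpha beta.
Proof.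
rewrite /young_constant.
have : 0 <= `|alpha|^-1 by rewrite invr_ge0.
have : 0 <= `|beta|^-1 by rewrite invr_ge0.
have : 0 <= `|alpha - beta|^-1 by rewrite invr_ge0.
lra.
Qed.

(** The bound is kept pointwise in [x], with [A] exposed, because it serves twice: finiteness of [A]
    almost everywhere gives absolute convergence, and its integral gives the norm bound. *)
Lemma bilinear_young_powR (alpha beta t1 t2 t3 s : R) (G1 G2 G3 : R -> R) :
  alpha != 0 -> beta != 0 -> alpha != beta ->
  measurable_fun [set: R] G1 -> measurable_fun [set: R] G2 ->
  measurable_fun [set: R] G3 ->
  (forall x, 0 <= G1 x) -> (forall x, 0 <= G2 x) -> (forall x, 0 <= G3 x) ->
  (\int[mu]_x (G1 x)%:E <= 1)%E -> (\int[mu]_x (G2 x)%:E <= 1)%E ->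
  (\int[mu]_x (G3 x)%:E <= 1)%E ->
  0 <= t1 <= 1 -> 0 <= t2 <= 1 -> 0 <= t3 <= 1 -> 0 <= s <= 1 ->
  t1 + t2 + t3 = 1 + s ->
  exists A : R -> \bar R, [/\ measurable_fun [set: R] A, (forall x, 0 <= A x)%E,
    (\int[mu]_x A x <= (young_constant alpha beta)%:E)%E &
    forall x, (\int[mu]_t (G1 (x - alpha * t)%R `^ t1 * G2 (x - beta * t)%R `^ t2 *
                           G3 t `^ t3)%:E <=
      A x `^ s * (young_constant alpha beta `^ (1 - s))%:E)%E].
Proof.
move=> al0 be0 ab0 m1 m2 m3 p1 p2 p3 i1 i2 i3 t101 t201 t301 s01 ts.
pose g1 (z : R * R) := G1 (z.1 - alpha * z.2).
pose g2 (z : R * R) := G2 (z.1 - beta * z.2).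
pose g3 (z : R * R) := G3 z.2.
have mg1 : measurable_fun [set: R * R] g1 by exact: measurable_shear.
have mg2 : measurable_fun [set: R * R] g2 by exact: measurable_shear.
have mg3 : measurable_fun [set: R * R] g3 by exact: (measurableT_comp m3).
pose u z := g2 z * g3 z + g1 z * g3 z + g1 z * g2 z.
have mu23 : measurable_fun [set: R * R] (g2 \* g3)%R by exact: measurable_funM.
have mu13 : measurable_fun [set: R * R] (g1 \* g3)%R by exact: measurable_funM.
have mu12 : measurable_fun [set: R * R] (g1 \* g2)%R by exact: measurable_funM.
have mU : measurable_fun [set: R * R] u.
  by apply: measurable_funD => //; exact: measurable_funD.
have g10 z : 0 <= g1 z by exact: p1.
have g20 z : 0 <= g2 z by exact: p2.
have g30 z : 0 <= g3 z by exact: p3.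
have u0 z : 0 <= u z by rewrite /u !addr_ge0 ?mulr_ge0.
have meU : measurable_fun [set: R * R] (fun z => (u z)%:E) by exact/measurable_EFinP.
have ile1 (x y : \bar R) (k : R) : 0 <= k -> (0 <= x <= 1 -> 0 <= y <= 1 ->
    k%:E * (x * y) <= k%:E)%E.
  move=> k0 /andP[x0 x1] /andP[y0 y1]; rewrite -[leRHS]mule1 lee_wpmul2l//.
  by rewrite -(mule1 1%E) lee_pmul.
have g1i : (0 <= \int[mu]_x (G1 x)%:E <= 1)%E.
  by rewrite i1 andbT integral_ge0// => x _; rewrite lee_fin.
have g2i : (0 <= \int[mu]_x (G2 x)%:E <= 1)%E.
  by rewrite i2 andbT integral_ge0// => x _; rewrite lee_fin.
have g3i : (0 <= \int[mu]_x (G3 x)%:E <= 1)%E.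
  by rewrite i3 andbT integral_ge0// => x _; rewrite lee_fin.
pose A (x : R) : \bar R := (\int[mu]_t (u (x, t))%:E)%E.
exists A; split.
- by apply: (measurable_fun_fubini_tonelli_F (m2 := mu) (fun z => (u z)%:E)).
- by move=> x; apply: integral_ge0 => t _; rewrite lee_fin.
- have fubini (w : R * R -> R) : measurable_fun [set: R * R] w -> (forall z, 0 <= w z) ->
      (\int[mu \x mu]_z (w z)%:E = \int[mu]_x \int[mu]_t (w (x, t))%:E)%E.
    move=> mw w0.
    apply: (fubini_tonelli1 (m1 := mu) (m2 := mu) (fun z => (w z)%:E)).
      exact/measurable_EFinP.
    by move=> z; rewrite lee_fin.
  have E23 : (\int[mu \x mu]_z (g2 z * g3 z)%:E <= 1)%E.
    rewrite fubini//; last by move=> z; rewrite mulr_ge0.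
    (* The forms x - beta t and t have determinant 1. *)
    have := integral_linear_forms G2 G3 beta 0 1.
    rewrite mul0r add0r normr1 invr1 => /(_ (oner_neq0 _) m2 m3 p2 p3).
    under eq_integral do under eq_integral do rewrite mul0r add0r mul1r.
    by move=> ->; exact: ile1.
  have E13 : (\int[mu \x mu]_z (g1 z * g3 z)%:E <= 1)%E.
    rewrite fubini//; last by move=> z; rewrite mulr_ge0.
    have := integral_linear_forms G1 G3 alpha 0 1.
    rewrite mul0r add0r normr1 invr1 => /(_ (oner_neq0 _) m1 m3 p1 p3).
    under eq_integral do under eq_integral do rewrite mul0r add0r mul1r.
    by move=> ->; exact: ile1.
  have E12 : (\int[mu \x mu]_z (g1 z * g2 z)%:E <= `|alpha - beta|^-1%:E)%E.
    rewrite fubini//; last by move=> z; rewrite mulr_ge0.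
    (* The forms x - alpha t and x - beta t have determinant alpha - beta, nonzero by hypothesis. *)
    have := integral_linear_forms G1 G2 alpha 1 (- beta).
    rewrite mul1r subr_eq0 => /(_ ab0 m1 m2 p1 p2).
    under eq_integral do under eq_integral do rewrite mul1r mulNr.
    by move=> ->; apply: ile1; rewrite ?invr_ge0.
  rewrite -fubini//.
  under eq_integral do rewrite /u !EFinD.
  rewrite ge0_integralD//; first last.
  + exact/measurable_EFinP.
  + by move=> z _; rewrite lee_fin mulr_ge0.
  + by apply: emeasurable_funD; exact/measurable_EFinP.
  + by move=> z _; rewrite -EFinD lee_fin addr_ge0// mulr_ge0.
  rewrite ge0_integralD//; first last.
  + exact/measurable_EFinP.
  + by move=> z _; rewrite lee_fin mulr_ge0.
  + exact/measurable_EFinP.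
  + by move=> z _; rewrite lee_fin mulr_ge0.
  apply: (le_trans (leeD (leeD E23 E13) E12)).
  rewrite -!EFinD lee_fin /young_constant.
  have : 0 <= `|alpha|^-1 by rewrite invr_ge0.
  have : 0 <= `|beta|^-1 by rewrite invr_ge0.
  lra.
- move=> x.
  have [s0 s1] := andP s01.
  have mx (f : R * R -> R) : measurable_fun [set: R * R] f ->
      measurable_fun [set: R] (fun t : R => f (x, t) : R).
    by move=> mf; exact: (measurableT_comp mf).
  have v0 t : 0 <= g1 (x, t) + g2 (x, t) + g3 (x, t) by rewrite !addr_ge0.
  apply: (@le_trans _ _ (\int[mu]_t (u (x, t) `^ s *
      (g1 (x, t) + g2 (x, t) + g3 (x, t)) `^ (1 - s))%:E)%E).
    have mgx (w : R) (f : R -> R) : measurable_fun [set: R] f ->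
        measurable_fun [set: R] (fun t => f t `^ w).
      by move=> mf; exact: (measurableT_comp (measurable_powR _)).
    apply: ge0_le_integral => //.
    + by move=> t _; rewrite lee_fin !mulr_ge0 ?powR_ge0.
    + apply/measurable_EFinP; apply: measurable_funM; last exact: mgx.
      apply: measurable_funM; apply: mgx.
        exact: (mx _ mg1).
      exact: (mx _ mg2).
    + apply/measurable_EFinP; apply: measurable_funM; apply: mgx.
        exact: mx.
      by do ![apply: measurable_funD]; exact: mx.
    + by move=> t _; rewrite lee_fin; exact: prod3_powR_le.
  apply: le_trans (hoelder_powR _ _ _ _ _ _ _ _ _) _ => //.
  + exact: mx.
  + by do ![apply: measurable_funD]; exact: mx.
  apply: lee_wpmul2l; first exact: poweR_ge0.
  rewrite -poweR_EFin; apply: gt0_ler_poweR; rewrite ?subr_ge0//.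
  + by rewrite in_itv/= leey andbT integral_ge0// => t _; rewrite lee_fin.
  + by rewrite in_itv/= leey andbT lee_fin (le_trans _ (young_constant_ge1 _ _)).
  under eq_integral do rewrite !EFinD.
  have mex (f : R * R -> R) : measurable_fun [set: R * R] f ->
      measurable_fun [set: R] (fun t => (f (x, t))%:E).
    by move=> mf; apply/measurable_EFinP; exact: mx.
  rewrite ge0_integralD//; first last.
  + exact: mex.
  + by move=> t _; rewrite lee_fin.
  + by apply: emeasurable_funD; exact: mex.
  + by move=> t _; rewrite -EFinD lee_fin addr_ge0.
  rewrite ge0_integralD//; first last.
  + exact: mex.
  + by move=> t _; rewrite lee_fin.
  + exact: mex.
  + by move=> t _; rewrite lee_fin.
  (* For fixed [x], the substitution in [t] costs a factor 1/|a|; here alpha and beta must be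
     nonzero. *)
  have aff (f : R -> R) (a : R) : a != 0 -> measurable_fun [set: R] f ->
      (forall y, 0 <= f y) -> (\int[mu]_y (f y)%:E <= 1)%E ->
      (\int[mu]_t (f (x - a * t))%:E <= `|a|^-1%:E)%E.
    move=> a0 mf f0 if1.
    under eq_integral do rewrite addrC -mulNr.
    rewrite (ge0_integral_affine (- a) x (EFin \o f))//.
    + by rewrite normrN -[leRHS]mule1 lee_wpmul2l// lee_fin invr_ge0.
    + by rewrite oppr_eq0.
    + exact/measurable_EFinP.
  apply: (le_trans (leeD (leeD (aff _ _ al0 m1 p1 i1) (aff _ _ be0 m2 p2 i2)) i3)).
  rewrite -!EFinD lee_fin /young_constant.
  have : 0 <= `|alpha - beta|^-1 by rewrite invr_ge0.
  lra.
Qed.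

End young_nonnegative.

(** * Complex-valued functions: modulus, integral and norms *)

Section complex_valued.
Set Implicit Arguments.
Unset Strict Implicit.
Context {R : realType}.
Local Notation mu := (@lebesgue_measure R).
Implicit Types (z w : R[i]) (f g : R -> R[i]) (p : \bar R).

Lemma cmodE z : cmod z = Num.sqrt (complex.Re z ^+ 2 + complex.Im z ^+ 2).
Proof. by case: z. Qed.

Lemma cmod_ge0 z : 0 <= cmod z.
Proof. by rewrite cmodE sqrtr_ge0. Qed.

Lemma cmodM z w : cmod (z * w) = cmod z * cmod w.
Proof. exact: ComplexField.Normc.normcM. Qed.

Lemma Re_le_cmod z : `|complex.Re z| <= cmod z.
Proof. by rewrite cmodE -sqrtr_sqr ler_wsqrtr// lerDl sqr_ge0. Qed.

Lemma Im_le_cmod z : `|complex.Im z| <= cmod z.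
Proof. by rewrite cmodE -sqrtr_sqr ler_wsqrtr// lerDr sqr_ge0. Qed.

Lemma cmod_le_ReIm z : cmod z <= `|complex.Re z| + `|complex.Im z|.
Proof.
rewrite cmodE -[leRHS]ger0_norm ?addr_ge0// -sqrtr_sqr ler_wsqrtr//.
rewrite -(real_normK (num_real (complex.Re z))) -(real_normK (num_real (complex.Im z))).
by rewrite sqrrD lerD2r lerDl mulrn_wge0// mulr_ge0.
Qed.

Lemma measurable_cmod (d : measure_display) (T : measurableType d) (u : T -> R[i]) :
  measurable_fun [set: T] (fun x => complex.Re (u x)) ->
  measurable_fun [set: T] (fun x => complex.Im (u x)) ->
  measurable_fun [set: T] (fun x => cmod (u x)).
Proof.
move=> mr mi.
have -> : (fun x => cmod (u x)) = (fun x =>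
    ((complex.Re (u x)) ^+ 2 + (complex.Im (u x)) ^+ 2) `^ 2^-1).
  by apply/funext => x /=; rewrite cmodE powR12_sqrt// addr_ge0// sqr_ge0.
apply: (measurableT_comp (measurable_powR _)).
by apply: measurable_funD; exact: measurable_funX.
Qed.

Lemma measurable_ReM (d : measure_display) (T : measurableType d) (u v : T -> R[i]) :
  measurable_fun [set: T] (fun x => complex.Re (u x)) ->
  measurable_fun [set: T] (fun x => complex.Im (u x)) ->
  measurable_fun [set: T] (fun x => complex.Re (v x)) ->
  measurable_fun [set: T] (fun x => complex.Im (v x)) ->
  measurable_fun [set: T] (fun x => complex.Re (u x * v x)).
Proof.
move=> mur mui mvr mvi.
have -> : (fun x => complex.Re (u x * v x)) = (fun x =>
    complex.Re (u x) * complex.Re (v x) - complex.Im (u x) * complex.Im (v x)).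
  by apply/funext => x /=; case: (u x) (v x) => [? ?] [? ?].
by apply: measurable_funB; exact: measurable_funM.
Qed.

Lemma measurable_ImM (d : measure_display) (T : measurableType d) (u v : T -> R[i]) :
  measurable_fun [set: T] (fun x => complex.Re (u x)) ->
  measurable_fun [set: T] (fun x => complex.Im (u x)) ->
  measurable_fun [set: T] (fun x => complex.Re (v x)) ->
  measurable_fun [set: T] (fun x => complex.Im (v x)) ->
  measurable_fun [set: T] (fun x => complex.Im (u x * v x)).
Proof.
move=> mur mui mvr mvi.
have -> : (fun x => complex.Im (u x * v x)) = (fun x =>
    complex.Re (u x) * complex.Im (v x) + complex.Im (u x) * complex.Re (v x)).
  by apply/funext => x /=; case: (u x) (v x) => [? ?] [? ?].
by apply: measurable_funD; exact: measurable_funM.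
Qed.

Lemma cintegrable_cmod f : cmeasurable f ->
  (\int[mu]_x (cmod (f x))%:E < +oo)%E -> cintegrable f.
Proof.
move=> [mr mi] fi.
have cf : mu.-integrable [set: R] (fun x => (cmod (f x))%:E).
  apply/integrableP; split; first exact/measurable_EFinP/measurable_cmod.
  by under eq_integral do rewrite /= ger0_norm ?cmod_ge0//.
split; apply: le_integrable cf => //; try exact/measurable_EFinP.
- by move=> x _; rewrite lee_fin (le_trans (Re_le_cmod _))// ler_norm.
- by move=> x _; rewrite lee_fin (le_trans (Im_le_cmod _))// ler_norm.
Qed.

(** Real and imaginary parts are estimated separately, whence the factor 2, which passes into the
    final constant. *)
Lemma cmod_cintegral_le f : cintegrable f ->
  ((cmod (cintegral f))%:E <= 2%:E * \int[mu]_x (cmod (f x))%:E)%E.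
Proof.
move=> [fr fi].
have mr : measurable_fun [set: R] (fun x => complex.Re (f x)).
  by apply/measurable_EFinP; exact: (measurable_int _ fr).
have mi : measurable_fun [set: R] (fun x => complex.Im (f x)).
  by apply/measurable_EFinP; exact: (measurable_int _ fi).
have mf := measurable_cmod mr mi.
have bound (u : R -> R) : mu.-integrable [set: R] (EFin \o u) ->
    (forall x, `|u x| <= cmod (f x)) ->
    (`| \int[mu]_x u x |%:E <= \int[mu]_x (cmod (f x))%:E)%E.
  move=> iu uf; rewrite EFin_normr_Rintegral//.
  apply: (le_trans (le_abse_integral _ _ _)) => //; first exact: (measurable_int _ iu).
  apply: ge0_le_integral => //.
  - by apply: measurableT_comp => //; exact: (measurable_int _ iu).
  - exact/measurable_EFinP.
  - by move=> x _; rewrite lee_fin.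
apply: (@le_trans _ _ (`|\int[mu]_x complex.Re (f x)| + `|\int[mu]_x complex.Im (f x)|)%:E).
  by rewrite lee_fin; exact: (cmod_le_ReIm (cintegral f)).
rewrite EFinD (_ : 2%:E = 1 + 1)%E// ge0_muleDl// !mul1e.
apply: leeD; apply: bound => // x; [exact: Re_le_cmod|exact: Im_le_cmod].
Qed.

Lemma cintegral_linear (a : R[i]) f g : cintegrable f -> cintegrable g ->
  cintegral (fun x => a * f x + g x) = a * cintegral f + cintegral g.
Proof.
move=> [fr fi] [gr gi]; case: a => a b.
have iZ (c : R) (u : R -> R) : mu.-integrable [set: R] (EFin \o u) ->
    mu.-integrable [set: R] (EFin \o (fun x => c * u x)).
  by move=> iu; exact: (integrableZl measurableT c iu).
rewrite /cintegral.
have -> : \int[mu]_x complex.Re ((a +i* b)%C * f x + g x) =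
    a * \int[mu]_x complex.Re (f x) - b * \int[mu]_x complex.Im (f x) +
    \int[mu]_x complex.Re (g x).
  rewrite -!RintegralZl// -RintegralB//; [|exact: iZ..].
  rewrite -RintegralD//; last exact: (integrableB measurableT (iZ _ _ fr) (iZ _ _ fi)).
  by apply: eq_Rintegral => x _; case: (f x) (g x) => [? ?] [? ?].
have -> : \int[mu]_x complex.Im ((a +i* b)%C * f x + g x) =
    a * \int[mu]_x complex.Im (f x) + b * \int[mu]_x complex.Re (f x) +
    \int[mu]_x complex.Im (g x).
  rewrite -!RintegralZl// -RintegralD//; [|exact: iZ..].
  rewrite -RintegralD//; last exact: (integrableD measurableT (iZ _ _ fi) (iZ _ _ fr)).
  by apply: eq_Rintegral => x _; case: (f x) (g x) => [? ?] [? ?].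
by [].
Qed.

Lemma cLp_fineK p f : cLp p f -> (fine (cLnorm p f))%:E = cLnorm p f.
Proof. by move=> [_ fp]; rewrite fineK// ge0_fin_numE// Lnorm_ge0. Qed.

(** This selects the essential supremum in the norm of exponent [+oo]. *)
Lemma lebesgue_measureT_gt0 : (0 < mu [set: R])%E.
Proof. by rewrite -set_itvNyy lebesgue_measure_itv/= ?ltNyr ?lt0y. Qed.

(* For [p = +oo] any [G] works, since [0 `^ 0 = 1]. *)
Lemma cLp_powR_bound p f : (1 <= p)%E -> cLp p f ->
  exists G : R -> R, [/\ measurable_fun [set: R] G, (forall x, 0 <= G x),
    (\int[mu]_x (G x)%:E <= 1)%E &
    \forall x \ae mu, cmod (f x) <= fine (cLnorm p f) * G x `^ fine p^-1].
Proof.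
move=> p1 Lf; have [[mr mi] _] := Lf.
have mf : measurable_fun [set: R] (fun x => cmod (f x)) by exact: measurable_cmod.
have mef : measurable_fun [set: R] (fun x => (cmod (f x))%:E) by exact/measurable_EFinP.
have fin : cLnorm p f = (fine (cLnorm p f))%:E.
  by rewrite cLp_fineK.
(* A zero norm cannot be divided out, but then [f] vanishes almost everywhere. *)
have [f0|f0] := eqVneq (fine (cLnorm p f)) 0.
  exists (cst 0); split => //; first by rewrite integral0.
  rewrite f0 in fin *.
  have := @Lnorm_eq0_eq0 _ _ _ mu (fun x => (cmod (f x))%:E) p mef
    (lt_le_trans lte01 p1) fin.
  by apply: filterS => x /(_ I) [->]; rewrite mul0r.
have c0 : 0 < fine (cLnorm p f).
  by rewrite lt_neqAle eq_sym f0/= fine_ge0// Lnorm_ge0.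
set c := fine _ in fin c0 *.
case: p p1 {Lf f0} @c fin c0 => [r|_|//]; last first.
  move=> c fin c0.
  exists (cst 0); split => //; first by rewrite integral0.
  rewrite invey/=.
  have := ess_sup_ge mu (fun x => `|(cmod (f x))%:E|%E).
  have -> : ess_sup mu (fun x => `|(cmod (f x))%:E|%E) = c%:E.
    by rewrite -fin /cLnorm unlock lebesgue_measureT_gt0.
  apply: filterS => x; rewrite powRr0 mulr1 lee_fin.
  by rewrite ger0_norm ?cmod_ge0.
rewrite lee_fin => r1 c fin c0; have r0 : 0 < r by exact: lt_le_trans r1.
have cr0 : 0 < c `^ r by rewrite powR_gt0.
(* This is the [r]-th power of |f|/c, where c is the norm: its integral is 1, and the required bound
   is an equality everywhere. *)
exists (fun x => c `^ (- r) * cmod (f x) `^ r); split.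
- by apply: measurable_funM => //; exact: (measurableT_comp (measurable_powR _)).
- by move=> x; rewrite mulr_ge0 ?powR_ge0.
- under eq_integral do rewrite EFinM.
  rewrite ge0_integralZl_EFin ?powR_ge0//; first last.
  + by apply/measurable_EFinP; exact: (measurableT_comp (measurable_powR _)).
  + by move=> x _; rewrite lee_fin powR_ge0.
  have -> : (\int[mu]_x (cmod (f x) `^ r)%:E = (c `^ r)%:E)%E.
    rewrite -poweR_EFin -fin /cLnorm powR_Lnorm ?gt_eqF//.
    by apply: eq_integral => x _; rewrite /= ger0_norm ?cmod_ge0.
  by rewrite -EFinM powRN mulVf ?gt_eqF.
- apply: nearW => x; rewrite inver gt_eqF//= powRM ?powR_ge0//.
  rewrite -!powRrM mulNr divff ?gt_eqF// powRr1 ?cmod_ge0//.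
  by rewrite powR_inv1 ?(ltW c0)// mulrA divff ?mul1r// gt_eqF.
Qed.

End complex_valued.

(** * Measurability of parametrised integrals, and reciprocal exponents *)

(** Tonelli applies to the positive and negative parts separately, and [fine] is measurable.
    Sections may fail to be integrable, their integral then having whatever value [fine] assigns. *)
Lemma measurable_Rintegral_section {R : realType} {phi : R * R -> R} :
  measurable_fun [set: R * R] phi ->
  measurable_fun [set: R] (fun x => \int[@lebesgue_measure R]_t phi (x, t)).
Proof.
move=> /measurable_EFinP mphi; apply: (@measurableT_comp _ _ _ _ _ _ fine) => //.
under eq_fun do rewrite integralE.
have fubini (psi : R * R -> \bar R) : measurable_fun [set: R * R] psi ->
    (forall z, 0 <= psi z)%E ->
    measurable_fun [set: R] (fun x => \int[@lebesgue_measure R]_t psi (x, t))%E.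
  move=> mpsi psi0.
  exact: (measurable_fun_fubini_tonelli_F (m2 := @lebesgue_measure R) psi).
apply: emeasurable_funB.
- have := fubini _ (measurable_funepos mphi) (fun z => funepos_ge0 _ z).
  by apply: eq_measurable_fun => x _; apply: eq_integral => t _; rewrite !funeposE.
- have := fubini _ (measurable_funeneg mphi) (fun z => funeneg_ge0 _ z).
  by apply: eq_measurable_fun => x _; apply: eq_integral => t _; rewrite !funenegE.
Qed.

(** This moves the relation between the exponents from extended to real numbers, with 1/[+oo] =
    0. *)
Lemma inve_ge1P {R : realType} {p : \bar R} : (1 <= p)%E ->
  p^-1%E = (fine p^-1)%:E /\ 0 <= fine p^-1 <= 1.
Proof.
case: p => [r| |//]; last by rewrite invey/= lexx ler01.
rewrite lee_fin => r1; have r0 : 0 < r by exact: lt_le_trans r1.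
by rewrite inver gt_eqF//= invr_ge0 ltW// invf_le1.
Qed.

(** * The bilinear operator on L^p functions *)

Section bilinear_operator.
Set Implicit Arguments.
Unset Strict Implicit.
Context {R : realType}.
Variables (alpha beta : R) (p0 p1 p2 p3 : \bar R) (K : R -> R[i]).
Hypotheses (alpha0 : alpha != 0) (beta0 : beta != 0) (alpha_beta : alpha != beta).
Hypotheses (p0_ge1 : (1 <= p0)%E) (p1_ge1 : (1 <= p1)%E) (p2_ge1 : (1 <= p2)%E).
Hypothesis p3_ge1 : (1 <= p3)%E.
Hypothesis young_exponents : (p1^-1 + p2^-1 + p0^-1 = 1 + p3^-1)%E.
Hypothesis LpK : cLp p0 K.
Local Notation mu := (@lebesgue_measure R).
Local Notation H := (bilinear_H K alpha beta).
Local Notation integrand := (bilinear_integrand K alpha beta).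
Local Notation C := (young_constant alpha beta).
Local Notation s := (fine p3^-1).
Local Notation norm f g :=
  (fine (cLnorm p1 f) * fine (cLnorm p2 g) * fine (cLnorm p0 K)).
Implicit Types f g : R -> R[i].

Lemma measurable_bilinear_integrand f g : cmeasurable f -> cmeasurable g ->
  measurable_fun [set: R * R] (fun z => complex.Re (integrand f g z.1 z.2)) /\
  measurable_fun [set: R * R] (fun z => complex.Im (integrand f g z.1 z.2)).
Proof.
move=> [mfr mfi] [mgr mgi]; have [[mKr mKi] _] := LpK.
have mfgr := measurable_ReM (measurable_shear _ alpha mfr)
  (measurable_shear _ alpha mfi) (measurable_shear _ beta mgr) (measurable_shear _ beta mgi).
have mfgi := measurable_ImM (measurable_shear _ alpha mfr)
  (measurable_shear _ alpha mfi) (measurable_shear _ beta mgr) (measurable_shear _ beta mgi).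
split; [apply: measurable_ReM|apply: measurable_ImM] => //.
- exact: (measurableT_comp mKr).
- exact: (measurableT_comp mKi).
- exact: (measurableT_comp mKr).
- exact: (measurableT_comp mKi).
Qed.

Lemma cmeasurable_bilinear_integrand f g x : cmeasurable f -> cmeasurable g ->
  cmeasurable (integrand f g x).
Proof.
move=> mf mg; have [mr mi] := measurable_bilinear_integrand mf mg.
split; [exact: (measurableT_comp mr (pair1_measurable x))|
        exact: (measurableT_comp mi (pair1_measurable x))].
Qed.

Lemma cmeasurable_bilinear_H f g : cmeasurable f -> cmeasurable g ->
  cmeasurable (H f g).
Proof.
move=> mf mg; have [mr mi] := measurable_bilinear_integrand mf mg.
split.
- exact: (measurable_Rintegral_section mr).
- exact: (measurable_Rintegral_section mi).
Qed.

(** Each of [f], [g], [K] is dominated almost everywhere by its norm times a power of a function of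
    integral at most 1, which reduces to the nonnegative case. The exceptional set of [t] is null
    for each fixed [x], so the bound holds at every [x]. *)
Lemma bilinear_integrand_bound f g : cLp p1 f -> cLp p2 g ->
  exists A : R -> \bar R, [/\ measurable_fun [set: R] A, (forall x, 0 <= A x)%E,
    (\int[mu]_x A x <= C%:E)%E &
    forall x, (\int[mu]_t (cmod (integrand f g x t))%:E <=
      (norm f g)%:E * (A x `^ s * (C `^ (1 - s))%:E))%E].
Proof.
move=> Lf Lg.
have [G1 [mG1 G10 iG1 fG1]] := cLp_powR_bound p1_ge1 Lf.
have [G2 [mG2 G20 iG2 gG2]] := cLp_powR_bound p2_ge1 Lg.
have [G3 [mG3 G30 iG3 KG3]] := cLp_powR_bound p0_ge1 LpK.
have [E1 t1] := inve_ge1P p1_ge1; have [E2 t2] := inve_ge1P p2_ge1.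
have [E0 t0] := inve_ge1P p0_ge1; have [E3 t3] := inve_ge1P p3_ge1.
have ts : fine p1^-1 + fine p2^-1 + fine p0^-1 = 1 + s.
  by apply: EFin_inj; rewrite !EFinD -E0 -E1 -E2 -E3.
have [A [mA A0 iA hA]] := bilinear_young_powR alpha0 beta0 alpha_beta
  mG1 mG2 mG3 G10 G20 G30 iG1 iG2 iG3 t1 t2 t0 t3 ts.
exists A; split => // x.
have n0 (p : \bar R) (h : R -> R[i]) : 0 <= fine (cLnorm p h) by rewrite fine_ge0// Lnorm_ge0.
have nn0 : 0 <= norm f g by rewrite !mulr_ge0 ?n0.
apply: le_trans (lee_wpmul2l _ (hA x)); last by rewrite lee_fin.
have mG : measurable_fun [set: R] (fun t => G1 (x - alpha * t) `^ fine p1^-1 *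
    G2 (x - beta * t) `^ fine p2^-1 * G3 t `^ fine p0^-1).
  have mp (h : R -> R) r : measurable_fun [set: R] h ->
      measurable_fun [set: R] (fun t => h t `^ r).
    by move=> mh; exact: (measurableT_comp (measurable_powR _)).
  have msh (h : R -> R) a : measurable_fun [set: R] h ->
      measurable_fun [set: R] (fun t => h (x - a * t)).
    move=> /(measurable_shear _ a) mh.
    exact: (measurableT_comp mh (pair1_measurable x)).
  by do ![apply: measurable_funM]; apply: mp => //; exact: msh.
rewrite -ge0_integralZl_EFin//; first last.
- exact/measurable_EFinP.
- by move=> t _; rewrite lee_fin !mulr_ge0 ?powR_ge0.
have [[mf _] [mg _]] := (Lf, Lg).
have [mr mi] := cmeasurable_bilinear_integrand x mf mg.
apply: ae_ge0_le_integral => //.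
- by move=> t _; rewrite lee_fin cmod_ge0.
- exact/measurable_EFinP/measurable_cmod.
- by move=> t _; rewrite -EFinM lee_fin !mulr_ge0 ?powR_ge0 ?n0.
- by apply: measurable_funeM; exact/measurable_EFinP.
have Na : - alpha != 0 by rewrite oppr_eq0.
have Nb : - beta != 0 by rewrite oppr_eq0.
apply: (filterS3 _ _ (ae_affine (- alpha) x _ Na fG1) (ae_affine (- beta) x _ Nb gG2)
  KG3) => t hf hg hK _.
rewrite /bilinear_integrand !cmodM -EFinM lee_fin.
rewrite !mulNr !(addrC _ x) in hf hg.
apply: le_trans (ler_pM _ _ (ler_pM _ _ hf hg) hK) _; rewrite ?mulr_ge0 ?cmod_ge0//.
by rewrite le_eqVlt; apply/orP; left; apply/eqP; ring.
Qed.

(** [A] is integrable, hence finite almost everywhere, and wherever it is finite it bounds the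
    integral of the modulus. *)
Lemma ae_cintegrable_bilinear_integrand f g : cLp p1 f -> cLp p2 g ->
  \forall x \ae mu, cintegrable (integrand f g x).
Proof.
move=> Lf Lg; have [[mf _] [mg _]] := (Lf, Lg).
have [A [mA A0 iA hA]] := bilinear_integrand_bound Lf Lg.
have intA : mu.-integrable [set: R] A.
  apply/integrableP; split => //.
  by under eq_integral do rewrite gee0_abs//; rewrite (le_lt_trans iA)// ltry.
apply: filterS (integrable_ae measurableT intA) => x /(_ I) Ax.
apply: cintegrable_cmod; first exact: cmeasurable_bilinear_integrand.
apply: le_lt_trans (hA x) _.
rewrite -(fineK Ax) poweR_EFin -!EFinM.
exact: ltry.
Qed.

Lemma cLnorm_bilinear_H f g : cLp p1 f -> cLp p2 g ->
  (cLnorm p3 (H f g) <= (2 * C)%:E * cLnorm p0 K * cLnorm p1 f * cLnorm p2 g)%E.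
Proof.
move=> Lf Lg; have [[mf _] [mg _]] := (Lf, Lg).
have [A [mA A0 iA hA]] := bilinear_integrand_bound Lf Lg.
have [mHr mHi] := cmeasurable_bilinear_H mf mg.
have n0 (p : \bar R) (h : R -> R[i]) : 0 <= fine (cLnorm p h) by rewrite fine_ge0// Lnorm_ge0.
have C0 : 0 < C by exact: lt_le_trans (young_constant_ge1 _ _).
(* The 2 comes from the complex integral, the power [1 - s] of [C] from Hoelder's inequality, and
   the power [s] from the integral of [A]. *)
have : (cLnorm p3 (H f g) <= (2 * norm f g * C `^ (1 - s) * C `^ s)%:E)%E.
  apply: (@Lnorm_le_powR _ _ _ mu _ A) => //.
  - exact/measurable_EFinP/measurable_cmod.
  - by rewrite !mulr_ge0 ?powR_ge0 ?n0.
  - exact: ltW.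
  apply: filterS (ae_cintegrable_bilinear_integrand Lf Lg) => x ix.
  rewrite /= ger0_norm ?cmod_ge0//.
  apply: le_trans (cmod_cintegral_le ix) _.
  apply: le_trans (lee_wpmul2l _ (hA x)) _; first by rewrite lee_fin.
  by rewrite !EFinM -!muleA (muleC (A x `^ _)%E).
move=> /le_trans; apply.
rewrite -(cLp_fineK Lf) -(cLp_fineK Lg) -(cLp_fineK LpK) -!EFinM lee_fin.
have CE : C `^ (1 - s) * C `^ s = C.
  by rewrite -powRD ?subrK ?powRr1 ?(ltW C0)// (gt_eqF C0) implybT.
rewrite -[_ * C `^ _ * C `^ _]mulrA CE.
by rewrite le_eqVlt; apply/orP; left; apply/eqP; ring.
Qed.

(** Linearity in each argument is that of the integral at points where both integrands are
    integrable, thus almost everywhere. *)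
Lemma bounded_bilinear_bilinear_H : bounded_bilinear p1 p2 p3 H.
Proof.
split.
- move=> f g Lf Lg; have [[mf _] [mg _]] := (Lf, Lg).
  split; first exact: cmeasurable_bilinear_H.
  apply: le_lt_trans (cLnorm_bilinear_H Lf Lg) _.
  by rewrite -(cLp_fineK Lf) -(cLp_fineK Lg) -(cLp_fineK LpK) -!EFinM ltry.
- move=> a f1 f2 g L1 L2 Lg.
  have := ae_cintegrable_bilinear_integrand L2 Lg.
  apply: filterS2 (ae_cintegrable_bilinear_integrand L1 Lg) => x i1 i2.
  rewrite /bilinear_H -cintegral_linear//; congr cintegral.
  by apply/funext => t; rewrite /bilinear_integrand; ring.
- move=> a f g1 g2 Lf L1 L2.
  have := ae_cintegrable_bilinear_integrand Lf L2.
  apply: filterS2 (ae_cintegrable_bilinear_integrand Lf L1) => x i1 i2.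
  rewrite /bilinear_H -cintegral_linear//; congr cintegral.
  by apply/funext => t; rewrite /bilinear_integrand; ring.
- exists (2 * C * fine (cLnorm p0 K)) => f g Lf Lg.
  rewrite EFinM (cLp_fineK LpK).
  exact: cLnorm_bilinear_H.
Qed.

End bilinear_operator.

Theorem proposition3p2 (R : realType) (alpha beta : R) (p0 p1 p2 : \bar R)
    (alpha0 : alpha != 0) (beta0 : beta != 0) (alpha_beta : alpha != beta)
    (p0_ge1 : (1 <= p0)%E) (p1_ge1 : (1 <= p1)%E) (p2_ge1 : (1 <= p2)%E) :
  exists C : R, forall (p3 : \bar R) (K : R -> R[i]),
    (1 <= p3)%E ->
    (p1^-1 + p2^-1 + p0^-1 = 1 + p3^-1)%E ->
    cLp p0 K ->
    exists T : (R -> R[i]) -> (R -> R[i]) -> (R -> R[i]),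
      bounded_extension p1 p2 p3 (bilinear_H K alpha beta) T /\
      forall f g : R -> R[i], cLp p1 f -> cLp p2 g ->
        (\forall x \ae lebesgue_measure,
           cintegrable (bilinear_integrand K alpha beta f g x) /\
           T f g x = bilinear_H K alpha beta f g x) /\
        (cLnorm p3 (T f g) <=
           C%:E * cLnorm p0 K * cLnorm p1 f * cLnorm p2 g)%E.
Proof.
(* The constant is fixed before [p3] and [K]. *)
exists (2 * young_constant alpha beta) => p3 K p3_ge1 young_exponents LpK.
(* The integral converges absolutely almost everywhere for all L^p arguments, so the defining
   formula is itself the extension and agrees with the operator on Schwartz functions trivially. *)
exists (bilinear_H K alpha beta); split.
  split; last by move=> f g _ _; exact: nearW.
  exact: (bounded_bilinear_bilinear_H (p0 := p0)).
move=> f g Lf Lg; split; last exact: (cLnorm_bilinear_H (p0 := p0)).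
have := ae_cintegrable_bilinear_integrand alpha0 beta0 alpha_beta p0_ge1 p1_ge1
  p2_ge1 p3_ge1 young_exponents LpK Lf Lg.
by apply: filterS => x.
Qed.
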